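(* Let $S>8$ be an integer that is not a power of $2$, and let $N$ be such that $S<2^{N-1}$; put $G=2^{N-1}$. Let $\mathcal{E}$ be the bordered emanation table (skybox) of the $2^N$-ions with strut constant $S$ (a $2^{N-1}\times 2^{N-1}$ array with positions $0,\dots,2^{N-1}-1$ in each direction, whose border cells are the label lines and mirror label lines), and let $\mathcal{E}'$ be the emanation table of the $2^{N+1}$-ions with the same strut constant $S$, with positions $0,\dots,2^{N}-1$ in its bordered form. Consider the central block of $\mathcal{E}'$ consisting of the cells at positions $(2^{N-2}+p,\;2^{N-2}+q)$ with $0\le p,q\le 2^{N-1}-1$. Then: (1) The first and last rows of this block lie in the rows of $\mathcal{E}'$ labeled $G$ and $G+S$ respectively, the first and last columns lie in the columns labeled $G$ and $G+S$ respectively, and every non-corner border cell $(p,q)$ of $\mathcal{E}$ (that is, every entry of the four label lines) corresponds to a cell $(2^{N-2}+p,2^{N-2}+q)$ of $\mathcal{E}'$ that is filled (represents a DMZ) and whose content (the XOR of its row and column labels) equals the label-line entry at $(p,q)$ in $\mathcal{E}$. (2) For every interior cell $(p,q)$ of $\mathcal{E}$, $1\le p,q\le 2^{N-1}-2$, the cell $(2^{N-2}+p,2^{N-2}+q)$ of $\mathcal{E}'$ is filled if and only if the cell $(p,q)$ of $\mathcal{E}$ is filled, and in that case the two cells have the same content and the same edge-sign mark.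
   Context: Write $\oplus$ for bitwise XOR of nonnegative integers. The $2^N$-ions: the real algebra with basis $i_0=1,i_1,\dots,i_{2^N-1}$, with $i_a^2=-1$ for $a\ne 0$, $i_ai_b=-i_bi_a=\pm i_{a\oplus b}$ for distinct nonzero $a,b$. Signs are fixed by cyclically positive triplets (trips): ''$(a,b,c)$ is a trip'' means $i_ai_b=i_c$, $i_bi_c=i_a$, $i_ci_a=i_b$. Start from the trip $(1,2,3)$ of the Quaternions ($N=2$). Passing from the $2^{k}$-ions to the $2^{k+1}$-ions ($k\ge 2$), with $H=2^{k}$: (Rule 0) all old trips are kept; (Rule 1) $(u,H,H+u)$ is a trip for $0<u<H$; (Rule 2) for every trip $(a,b,c)$ with all entries $<H$, the triples $(a,c+H,b+H)$, $(b,a+H,c+H)$, $(c,b+H,a+H)$ are trips. Emanation table (ET): for the $2^N$-ions, $N\ge 4$, let $G=2^{N-1}$ and fix a strut constant $S$ with $0<S<G$. The labels (L-indices) are the integers $u$ with $1\le u\le G-1$, $u\neq S$. The strut-opposite of $u$ is $u\oplus S$. The Assessor of $u$ is the plane spanned by $i_u$ and $i_{U}$, where $U=G+(u\oplus S)$; its diagonals are the lines spanned by $i_u+i_U$ (slope $+$) and $i_u-i_U$ (slope $-$). Two labels $u,v$ form a DMZ if some diagonal of the Assessor of $u$ times some diagonal of the Assessor of $v$ is zero. Label order: the $G-2$ labels are assigned to positions $1,\dots,G-2$ (the same for rows and for columns) as follows: run through $1,2,3,\dots$ in increasing order; each integer that is not $S$ and not yet placed is put in the leftmost free position $p$, and its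 strut-opposite is at once put in the mirror position $G-1-p$. The ET is the $(G-2)\times(G-2)$ array in which the cell with row label $R$ and column label $C$ is filled exactly when $R,C$ form a DMZ, in which case its content is $P=R\oplus C$; otherwise it is blank. Cells with $R=C$ or $R\oplus C=S$ (the long diagonals) are always blank. Edge-sign mark: a filled cell is marked if its DMZs pair diagonals of equal slope, and unmarked if they pair diagonals of opposite slope. Bordered ET (skybox): add positions $0$ and $G-1$ in each direction, giving a $G\times G=2^{N-1}\times 2^{N-1}$ array. If $\ell(p)$ is the label at position $p$, $1\le p\le G-2$, the label lines are the entries $\ell(q)$ at $(0,q)$ and $\ell(p)$ at $(p,0)$; the mirror label lines are the entries $\ell(q)\oplus S$ at $(G-1,q)$ and $\ell(p)\oplus S$ at $(p,G-1)$. The four corner cells are empty. *)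

(* Defs.v *)
From mathcomp Require Import all_boot all_order all_algebra.
From mathcomp Require Import reals.

Set Implicit Arguments.
Unset Strict Implicit.
Unset Printing Implicit Defensive.

Import GRing.Theory.

Local Open Scope ring_scope.

(* Throughout, [Nat.lxor] is bitwise exclusive or. *)

(* One representative of each cyclic class of trips of the 2^N-ions. *)
Fixpoint trip_list (N : nat) : seq (nat * nat * nat) :=
  if N is k.+1 then
    if (k < 2)%N then (if k == 1%N then [:: (1, 2, 3)%N] else [::])
    else
      let H := (2 ^ k)%N in
      trip_list k
      ++ [seq (u, H, H + u)%N | u <- iota 1 (H - 1)]
      ++ flatten [seq (let: (a, b, c) := t in
                       [:: (a, c + H, b + H)%N;
                           (b, a + H, c + H)%N;
                           (c, b + H, a + H)%N]) | t <- trip_list k]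
  else [::].

Definition is_trip (N a b c : nat) : bool :=
  [|| (a, b, c) \in trip_list N,
      (b, c, a) \in trip_list N
    | (c, a, b) \in trip_list N].

(* i_a i_b = ion_sign a b * i_(a xor b).  For distinct nonzero a, b, exactly one
   of (a, b, a xor b) and (b, a, a xor b) is a trip. *)
Definition ion_sign (R : realType) (N a b : nat) : R :=
  if (a == 0%N) || (b == 0%N) then 1
  else if a == b then -1
  else if is_trip N a b (Nat.lxor a b) then 1 else -1.

Definition ions (R : realType) (N : nat) := 'rV[R]_(2 ^ N).

Definition ion (R : realType) (N a : nat) : ions R N :=
  \row_(j < 2 ^ N) ((j : nat) == a)%:R.

Definition ions_mul (R : realType) (N : nat) (x y : ions R N) : ions R N :=
  \row_(c < 2 ^ N)
    \sum_(a < 2 ^ N) \sum_(b < 2 ^ N | Nat.lxor a b == c)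
      ion_sign R N a b * x 0 a * y 0 b.

Definition gen (N : nat) : nat := (2 ^ N.-1)%N.

(* [neg = false] is the diagonal of slope +, [neg = true] that of slope -. *)
Definition diagonal (R : realType) (N S u : nat) (neg : bool) :
    {vspace 'rV[R]_(2 ^ N)} :=
  <[ion R N u + (-1) ^+ neg *: ion R N (gen N + Nat.lxor u S)]>%VS.

Definition zero_product (R : realType) (N S u v : nat) (s t : bool) : Prop :=
  forall x y : 'rV[R]_(2 ^ N),
    x \in diagonal R N S u s -> y \in diagonal R N S v t ->
    ions_mul (x : ions R N) y = 0.

Definition DMZ (R : realType) (N S u v : nat) : Prop :=
  exists s t : bool, zero_product R N S u v s t.

(* The state of the placement is a table of size G indexed by positions; the
   entry 0, which is not a label, stands for a free position.  Positions 0 and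
   G - 1 are outside the table of labels and are never filled. *)
Definition place (G S : nat) (t : seq nat) (u : nat) : seq nat :=
  if (u == S) || (u \in t) then t
  else
    let p := (index 0%N (behead t)).+1 in
    set_nth 0%N (set_nth 0%N t p u) (G - 1 - p) (Nat.lxor u S).

Definition label_table (N S : nat) : seq nat :=
  foldl (place (gen N) S) (nseq (gen N) 0%N) (iota 1 (gen N - 1)).

Definition label (N S p : nat) : nat := nth 0%N (label_table N S) p.

Definition interior (N p : nat) : bool := (1 <= p <= gen N - 2)%N.

Definition filled (R : realType) (N S p q : nat) : Prop :=
  [/\ interior N p, interior N q & DMZ R N S (label N S p) (label N S q)].

Definition content (N S p q : nat) : nat :=
  Nat.lxor (label N S p) (label N S q).

(* [edge_sign R N S p q true]: the cell (p, q) is filled and marked;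
   [edge_sign R N S p q false]: it is filled and unmarked. *)
Definition edge_sign (R : realType) (N S p q : nat) (mark : bool) : Prop :=
  filled R N S p q /\
  forall s t : bool,
    zero_product R N S (label N S p) (label N S q) s t -> (s == t) = mark.

(* [label_line N S p q x]: (p, q) is a non-corner border cell of the skybox,
   with entry x. *)
Inductive label_line (N S : nat) : nat -> nat -> nat -> Prop :=
| label_line_top q of interior N q :
    label_line N S 0 q (label N S q)
| label_line_left p of interior N p :
    label_line N S p 0 (label N S p)
| label_line_bottom q of interior N q :
    label_line N S (gen N - 1) q (Nat.lxor (label N S q) S)
| label_line_right p of interior N p :
    label_line N S p (gen N - 1) (Nat.lxor (label N S p) S).

(* Main.v *)
From Stdlib Require Import PeanoNat.
Require Import Defs.
From mathcomp Require Import all_boot all_order all_algebra.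
From mathcomp Require Import reals zify.

(** Write [u'] for [u xor S] and [sgn(a, b)] for the sign in
    [i_a i_b = sgn(a, b) i_(a xor b)].

    Filling and marking depend on few signs.  For labels [u], [v] below [G],
    expanding [(i_u + s i_(G + u')) (i_v + t i_(G + v'))] leaves one
    coefficient on [i_(u xor v)] and one on [i_(G + (u xor v xor S))], each a
    sum of two signs.  Doubling expresses the signs of indices [G + a] by those
    below [G], and the product vanishes exactly when
      [s t = sgn(u, v) sgn(u', v') = - sgn(u, v') sgn(u', v)]
    and [u] is neither [v] nor [v'] ([zero_product_label]).  So whether the cell
    is filled is read off the product of four signs, and its mark is the
    product of two of them.

    Doubling moves labels into the centre.  If [2^s] is the top bit of [S], the
    first half of the label order lists in increasing order the integers
    without that bit, by a formula that does not mention the level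
    ([low_label], [labelE]); the second half is the mirror image.  The top bit
    of [S] is below [G], so moving a quarter of the way into the larger table
    adds exactly [G] to the label, and mirroring preserves this
    ([label_shift]).  The central block of the larger table therefore carries
    the old labels raised by [G], bordered by [G] and [G + S].

    Raising two labels by [G] exchanges the arguments of every sign above, hence
    negates all four of them.  Products of two or of four are unchanged, so the
    interior cells keep filling and mark, indeed the same pairs of diagonals
    annihilate each other ([zero_product_shift]); contents agree because the
    two copies of [G] cancel in the xor.  For a border cell one label is [G] or
    [G + S], and the product of the four signs reduces to
    [sgn(v, S) sgn(v', S)], which is negative because multiplying twice by [i_S]
    negates ([DMZ_border]). *)

Set Implicit Arguments.
Unset Strict Implicit.
Unset Printing Implicit Defensive.

Import GRing.Theory Num.Theory.

Local Notation "a ^^ b" := (Nat.lxor a b) (at level 40, left associativity).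

(** * Exclusive or and binary digits *)

Lemma shiftrE a k : Nat.shiftr a k = a %/ 2 ^ k.
Proof.
have div2E n : Nat.div2 n = n./2.
  by elim/ltn_ind: n => -[|[|n]] //= IH; rewrite IH.
elim: k => [|k IHk]; first by rewrite divn1.
by rewrite expnSr divnMA divn2 -IHk -div2E.
Qed.

(** Division by [2 ^ k] drops the [k] low digits, so it commutes with xor; the
    bounds below come from comparing the digits that remain. *)
Lemma divn_lxor k a b : (a ^^ b) %/ 2 ^ k = (a %/ 2 ^ k) ^^ (b %/ 2 ^ k).
Proof. by rewrite -!shiftrE Nat.shiftr_lxor. Qed.

Lemma lxor_lt k a b : a < 2 ^ k -> b < 2 ^ k -> a ^^ b < 2 ^ k.
Proof.
move=> ha hb; have k0 : 0 < 2 ^ k by rewrite expn_gt0.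
by rewrite -[_ < _]negbK -leqNgt -divn_gt0 // divn_lxor !divn_small.
Qed.

Lemma odd_lxor a b : odd (a ^^ b) = odd a (+) odd b.
Proof.
have oddE n : odd n = Nat.testbit n 0.
  by elim/ltn_ind: n => -[|[|n]] //= IH; rewrite negbK IH //.
by rewrite !oddE Nat.lxor_spec; case: Nat.testbit; case: Nat.testbit.
Qed.

Lemma addn_pow2_lxor k a : a < 2 ^ k -> 2 ^ k + a = 2 ^ k ^^ a.
Proof.
move=> ha; apply: Nat.add_nocarry_lxor; apply: Nat.bits_inj => i.
rewrite Nat.land_spec Nat.bits_0.
have -> : 2 ^ k = Nat.pow 2 k by elim: (k) => //= n <-; rewrite expnS; lia.
rewrite Nat.pow2_bits_eqb; case: Nat.eqb_spec => //= <-.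
have /= := Nat.shiftr_spec a k 0 (Nat.le_0_l _).
by rewrite shiftrE divn_small // => <-.
Qed.

Lemma lxor_eq0 a b : (a ^^ b == 0) = (a == b).
Proof.
apply/eqP/eqP => [|->]; first exact: Nat.lxor_eq.
exact: Nat.lxor_nilpotent.
Qed.

Lemma lxorK b : involutive (Nat.lxor^~ b).
Proof. by move=> a; rewrite Nat.lxor_assoc Nat.lxor_nilpotent Nat.lxor_0_r. Qed.

(** Indices at or above [2 ^ k] are written [2 ^ k + a] with [a < 2 ^ k]; these
    rules give the xor of two indices in that form. *)
Section HighBit.
Variables (k a b : nat).
Hypotheses (ha : a < 2 ^ k) (hb : b < 2 ^ k).

Lemma lxor_highl : (2 ^ k + a) ^^ b = 2 ^ k + (a ^^ b).
Proof. by rewrite !addn_pow2_lxor ?lxor_lt // Nat.lxor_assoc. Qed.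

Lemma lxor_highr : a ^^ (2 ^ k + b) = 2 ^ k + (a ^^ b).
Proof.
rewrite !addn_pow2_lxor ?lxor_lt // -Nat.lxor_assoc [a ^^ _]Nat.lxor_comm.
by rewrite Nat.lxor_assoc.
Qed.

Lemma lxor_high2 : (2 ^ k + a) ^^ (2 ^ k + b) = a ^^ b.
Proof.
rewrite !addn_pow2_lxor // [_ ^^ a]Nat.lxor_comm Nat.lxor_assoc.
by rewrite -[2 ^ k ^^ _]Nat.lxor_assoc Nat.lxor_nilpotent Nat.lxor_0_l.
Qed.

End HighBit.

(** * Trips and signs under doubling *)

Lemma is_trip_rot N a b c : is_trip N b c a = is_trip N a b c.
Proof.
by rewrite /is_trip; case: (_ \in _); case: (_ \in _); case: (_ \in _).
Qed.

(** The three triples that Rule 2 makes from one trip are a single rule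
    [(x, z + H, y + H)], applied to the three rotations [(x, y, z)] of it. *)
Lemma mem_trip_listS k a b c : 1 < k ->
  ((a, b, c) \in trip_list k.+1) =
  [|| (a, b, c) \in trip_list k,
      [&& 0 < a < 2 ^ k, b == 2 ^ k & c == 2 ^ k + a]
    | [&& 2 ^ k <= b, 2 ^ k <= c & is_trip k a (c - 2 ^ k) (b - 2 ^ k)]].
Proof.
move=> k1 /=; rewrite ltnNge k1 /= !mem_cat; congr [|| _, _ | _].
  have H0 : 0 < 2 ^ k by rewrite expn_gt0.
  apply/mapP/idP => [[u] | /and3P[ha /eqP-> /eqP->]].
    by rewrite mem_iota => hu [-> -> ->]; rewrite !eqxx !andbT; lia.
  by exists a => //; rewrite mem_iota; lia.
apply/flatten_mapP/idP => [[[[x y] z] xyz] | /and3P[hb hc]].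
  rewrite /= !inE => /or3P[] /eqP[-> -> ->];
    by rewrite !leq_addl !addnK /is_trip xyz ?orbT.
by case/or3P=> mem; [exists (a, c - 2 ^ k, b - 2 ^ k)
  | exists (c - 2 ^ k, b - 2 ^ k, a) | exists (b - 2 ^ k, a, c - 2 ^ k)];
  rewrite ?mem //= !inE !subnK // eqxx ?orbT.
Qed.

Lemma trip_list_bounds k a b c : (a, b, c) \in trip_list k ->
  [/\ 0 < a < 2 ^ k, 0 < b < 2 ^ k & 0 < c < 2 ^ k].
Proof.
elim: k a b c => // k IHk a b c.
case: (ltnP 1 k) => [k1 | ]; last first.
  by case: k {IHk} => [|[|]] //= _; rewrite inE => /eqP[-> -> ->].
rewrite mem_trip_listS // expnS => /or3P[/IHk[] | /and3P[] | ].
- by move=> *; split; lia.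
- by move=> ? /eqP-> /eqP->; split; lia.
by case/and3P=> hb hc /or3P[] /IHk[]; split; lia.
Qed.

Lemma is_trip_bounds k a b c : is_trip k a b c ->
  [/\ 0 < a < 2 ^ k, 0 < b < 2 ^ k & 0 < c < 2 ^ k].
Proof. by case/or3P=> /trip_list_bounds[]. Qed.

Lemma is_tripS k a b c : 1 < k ->
  let H := 2 ^ k in
  let rule1 x y z := [&& 0 < x < H, y == H & z == H + x] in
  let rule2 x y z := [&& H <= y, H <= z & is_trip k x (z - H) (y - H)] in
  is_trip k.+1 a b c =
  [|| is_trip k a b c, rule1 a b c, rule1 b c a, rule1 c a b,
      rule2 a b c, rule2 b c a | rule2 c a b].
Proof.
move=> k1 H rule1 rule2; rewrite {1 2}/is_trip !mem_trip_listS //.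
rewrite -/(rule1 a b c) -/(rule1 b c a) -/(rule1 c a b).
rewrite -/(rule2 a b c) -/(rule2 b c a) -/(rule2 c a b).
have orbAC : forall p1 q1 r1 p2 q2 r2 p3 q3 r3 : bool,
    [|| [|| p1, q1 | r1], [|| p2, q2 | r2] | [|| p3, q3 | r3]] =
    [|| [|| p1, p2 | p3], q1, q2, q3, r1, r2 | r3] by do 9!case.
exact: orbAC.
Qed.

(** [ion_neg N a b] tells whether [i_a i_b] is [- i_(a xor b)].  A boolean makes
    products of signs into exclusive disjunctions. *)
Definition ion_neg N a b : bool :=
  (a != 0) && (b != 0) && ((a == b) || ~~ is_trip N a b (a ^^ b)).

Section Doubling.
Variables (k : nat) (k1 : 1 < k).
Let H := 2 ^ k.

Lemma is_trip_low a b c : a < H -> b < H -> c < H ->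
  is_trip k.+1 a b c = is_trip k a b c.
Proof.
rewrite is_tripS // -/H => ha hb hc.
have ltF x y : x < H -> [&& H <= x & y] = false.
  by move=> xH; rewrite leqNgt xH.
have eqF x : x < H -> (x == H) = false by lia.
by rewrite !ltF ?eqF //= !andbF !orbF.
Qed.

Lemma is_trip_high a b c : 0 < a < H -> 0 < b < H -> 0 < c < H ->
  is_trip k.+1 a (H + b) (H + c) = is_trip k a c b.
Proof.
rewrite is_tripS // -/H => ha hb hc.
have noT : is_trip k a (H + b) (H + c) = false.
  by apply/negP => /is_trip_bounds[]; rewrite -/H; lia.
have -> : (H + b == H) = false by lia.
have -> : (H + c == H) = false by lia.
have -> : (a == H) = false by lia.
have -> : H <= a = false by lia.
by rewrite noT !leq_addr !addKn /= !andbF !orbF.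
Qed.

Lemma is_trip_gen a : 0 < a < H ->
  is_trip k.+1 a H (H + a) /\ ~~ is_trip k.+1 H a (H + a).
Proof.
move=> ha; rewrite !is_tripS // -/H ha !eqxx /= orbT; split => //.
have noT x y z : is_trip k x y z -> [&& 0 < x, x < H & 0 < y].
  by case/is_trip_bounds => /andP[-> ->] /andP[-> _].
apply/negP => /or4P[/noT||| /or4P[||/and3P[_ _ /noT]|]]; lia.
Qed.

(** Rule 1: the products that involve the generator [i_H]. *)
Lemma ion_neg_gen a : 0 < a < H ->
  [/\ ion_neg k.+1 a H = false, ion_neg k.+1 H a = true,
      ion_neg k.+1 H (H + a) = false, ion_neg k.+1 (H + a) H = true
    & ion_neg k.+1 (H + a) a = false /\ ion_neg k.+1 a (H + a) = true].
Proof.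
move=> ha; have [T F] := is_trip_gen ha.
have H0 : 0 < H by rewrite expn_gt0.
have ha' : a < 2 ^ k by case/andP: ha.
have aH : a ^^ H = H + a by rewrite addn_pow2_lxor // Nat.lxor_comm.
have aHa : a ^^ (H + a) = H
  by rewrite -aH Nat.lxor_comm [a ^^ _]Nat.lxor_comm lxorK.
have HHa : H ^^ (H + a) = a by rewrite -aH Nat.lxor_comm lxorK.
have negE x y z : x != 0 -> y != 0 -> x != y -> x ^^ y = z ->
    ion_neg k.+1 x y = ~~ is_trip k.+1 x y z.
  by rewrite /ion_neg => -> -> /negPf -> ->.
have HaH : (H + a) ^^ H = a by rewrite Nat.lxor_comm.
have Haa : (H + a) ^^ a = H by rewrite Nat.lxor_comm.
have Ha : H ^^ a = H + a by rewrite Nat.lxor_comm.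
split; [..|split];
  [ rewrite (negE _ _ _ _ _ _ aH) | rewrite (negE _ _ _ _ _ _ Ha)
  | rewrite (negE _ _ _ _ _ _ HHa) 1?is_trip_rot
  | rewrite (negE _ _ _ _ _ _ HaH) 2?is_trip_rot
  | rewrite (negE _ _ _ _ _ _ Haa) 2?is_trip_rot
  | rewrite (negE _ _ _ _ _ _ aHa) 1?is_trip_rot ]; rewrite ?T ?F //; lia.
Qed.

Lemma ion_neg_low a b : a < H -> b < H -> ion_neg k.+1 a b = ion_neg k a b.
Proof. by move=> ha hb; rewrite /ion_neg is_trip_low // lxor_lt. Qed.

(** Rule 2: whichever of the two indices is raised by [H], the sign becomes that
    of the product in the opposite order. *)
Section Pair.
Variables (a b : nat).
Hypotheses (ha : 0 < a < H) (hb : 0 < b < H) (ab : a != b).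

Let a_lt : a < 2 ^ k. Proof. by case/andP: ha. Qed.
Let b_lt : b < 2 ^ k. Proof. by case/andP: hb. Qed.
Let c_gt0_lt : 0 < a ^^ b < H.
Proof. by rewrite lxor_lt // andbT lt0n lxor_eq0. Qed.

Let ion_negE : ion_neg k b a = ~~ is_trip k b a (a ^^ b).
Proof.
rewrite /ion_neg [b == a]eq_sym (negPf ab) -!lt0n [b ^^ a]Nat.lxor_comm.
by case/andP: ha => ->; case/andP: hb => ->.
Qed.

Lemma ion_neg_low_high : ion_neg k.+1 a (H + b) = ion_neg k b a.
Proof.
rewrite ion_negE /ion_neg lxor_highr // is_trip_high // is_trip_rot.
have [-> -> ->] //: [/\ a != 0, H + b != 0 & (a == H + b) = false].
by split; lia.
Qed.

Lemma ion_neg_high_low : ion_neg k.+1 (H + a) b = ion_neg k b a.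
Proof.
rewrite ion_negE /ion_neg lxor_highl // -is_trip_rot is_trip_high //.
have [-> -> ->] //: [/\ H + a != 0, b != 0 & (H + a == b) = false].
by split; lia.
Qed.

Lemma ion_neg_high2 : ion_neg k.+1 (H + a) (H + b) = ion_neg k b a.
Proof.
rewrite ion_negE /ion_neg lxor_high2 // is_trip_rot is_trip_high //.
rewrite 2!is_trip_rot.
have [-> -> ->] //: [/\ H + a != 0, H + b != 0 & (H + a == H + b) = false].
by split; lia.
Qed.

End Pair.

End Doubling.

(** Distinct imaginary units anticommute.  The doubling rules reduce the claim
    for two units to the claim for the same units lowered by [2 ^ k], except
    when the generator is involved, where Rule 1 gives both orders. *)
Lemma ion_neg_swap k a b : 1 < k -> 0 < a < 2 ^ k -> 0 < b < 2 ^ k -> a != b ->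
  ion_neg k b a = ~~ ion_neg k a b.
Proof.
elim: k a b => // k IHk a b; rewrite ltnS leq_eqVlt => /orP[/eqP <- | k1].
  by do 4?[case: a => [|a] //]; do 4?[case: b => [|b] //].
wlog ab : a b / a < b.
  move=> W ha hb; rewrite neq_ltn => /orP[] h.
    by apply: W; rewrite // neq_ltn h.
  by rewrite (W b a) ?negbK // neq_ltn h.
rewrite expnS mul2n -addnn => ha hb _.
have [b_lt | b_ge] := ltnP b (2 ^ k).
  by rewrite !ion_neg_low 1?IHk //; lia.
rewrite -(subnKC b_ge) in ab hb *; move: (b - 2 ^ k) => {b b_ge} b in ab hb *.
have [b0 | b_gt0] := posnP b.
  rewrite b0 addn0 in ab *; have aP : 0 < a < 2 ^ k by lia.
  by have [-> ->] := ion_neg_gen k1 aP.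
have bP : 0 < b < 2 ^ k by lia.
have [a_lt | a_ge] := ltnP a (2 ^ k).
  have [-> | ab'] := eqVneq a b.
    by have [_ _ _ _ [-> ->]] := ion_neg_gen k1 bP.
  by rewrite ion_neg_low_high ?ion_neg_high_low 1?IHk //; lia.
rewrite -(subnKC a_ge) in ab ha *; move: (a - 2 ^ k) => {a a_ge} a in ab ha *.
have [-> | a_gt0] := posnP a.
  by rewrite addn0; have [_ _ -> ->] := ion_neg_gen k1 bP.
by rewrite !ion_neg_high2 1?IHk //; lia.
Qed.

Lemma label_opposite k S u : 0 < S < 2 ^ k -> 0 < u < 2 ^ k -> u != S ->
  [/\ 0 < u ^^ S < 2 ^ k, u ^^ S != S & u ^^ S != u].
Proof.
move=> /andP[S0 SG] /andP[u0 uG] uS; split.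
- by rewrite lxor_lt // andbT lt0n lxor_eq0.
- by rewrite -lxor_eq0 lxorK -lt0n.
- by rewrite -lxor_eq0 [u ^^ S]Nat.lxor_comm lxorK -lt0n.
Qed.

(** This is [(i_a i_S) i_S = - i_a]: exactly one of the orders [(a, S)] and
    [(a xor S, S)] agrees with the trip on [a], [S], [a xor S]. *)
Lemma ion_neg_opposite k a S : 1 < k -> 0 < S < 2 ^ k -> 0 < a < 2 ^ k ->
  a != S -> ion_neg k (a ^^ S) S = ~~ ion_neg k a S.
Proof.
move=> k1 SP aP aS; have [a'P a'S _] := label_opposite SP aP aS.
rewrite (ion_neg_swap k1 SP a'P) 1?eq_sym //.
have negE x y : 0 < x -> 0 < y -> x != y ->
    ion_neg k x y = ~~ is_trip k x y (x ^^ y).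
  by rewrite /ion_neg -!lt0n => -> -> /negPf ->.
rewrite !negE 1?eq_sym //; try lia.
rewrite [S ^^ _]Nat.lxor_comm lxorK negbK negbK.
by rewrite -is_trip_rot -is_trip_rot.
Qed.

(** * Zero products of diagonals *)

Section Algebra.
Local Open Scope ring_scope.

Variables (R : realType) (N : nat).
Implicit Types (x y : 'rV[R]_(2 ^ N)) (a b c : nat) (r : R).
Local Notation mul := (@ions_mul R N).
Local Notation i_ := (@ion R N).

Lemma ion_signE a b : ion_sign R N a b = (-1) ^+ ion_neg N a b.
Proof.
rewrite /ion_sign /ion_neg; case: eqP => //= _; case: eqP => //= _.
by case: eqP => //= _; case: is_trip.
Qed.

Lemma sum_signs_eq0 (p q : bool) :
  ((-1) ^+ p + (-1) ^+ q == 0 :> R) = p (+) q.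
Proof.
have two : (1 + 1 == 0 :> R) = false by rewrite -(natrD _ 1 1) pnatr_eq0.
case: p; case: q; rewrite ?expr0 ?expr1 ?subrr ?addNr ?eqxx //.
by rewrite -opprD oppr_eq0.
Qed.

Lemma ions_mulDl x1 x2 y : mul (x1 + x2) y = mul x1 y + mul x2 y.
Proof.
apply/rowP => c; rewrite !mxE -big_split; apply: eq_bigr => a _.
by rewrite -big_split; apply: eq_bigr => b _; rewrite mxE mulrDr mulrDl.
Qed.

Lemma ions_mulDr x y1 y2 : mul x (y1 + y2) = mul x y1 + mul x y2.
Proof.
apply/rowP => c; rewrite !mxE -big_split; apply: eq_bigr => a _.
by rewrite -big_split; apply: eq_bigr => b _; rewrite mxE mulrDr.
Qed.

Lemma ions_mulZl r x y : mul (r *: x) y = r *: mul x y.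
Proof.
apply/rowP => c; rewrite !mxE mulr_sumr; apply: eq_bigr => a _.
by rewrite mulr_sumr; apply: eq_bigr => b _; rewrite mxE mulrCA !mulrA.
Qed.

Lemma ions_mulZr r x y : mul x (r *: y) = r *: mul x y.
Proof.
apply/rowP => c; rewrite !mxE mulr_sumr; apply: eq_bigr => a _.
by rewrite mulr_sumr; apply: eq_bigr => b _; rewrite mxE mulrCA.
Qed.

Lemma ions_mul_ion a b : (a < 2 ^ N)%N -> (b < 2 ^ N)%N ->
  mul (i_ a) (i_ b) = ion_sign R N a b *: i_ (a ^^ b).
Proof.
move=> ha hb; apply/rowP => c; rewrite !mxE.
rewrite (bigD1 (Ordinal ha)) //= [X in _ + X]big1 ?addr0; last first.
  move=> a' a'a; rewrite big1 // => b' _; rewrite !mxE.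
  suff -> : ((a' : nat) == a) = false by rewrite mulr0 mul0r.
  by apply: contraNF a'a => /eqP aE; apply/eqP/val_inj.
have [cE | cN] := eqVneq (c : nat) (a ^^ b).
  rewrite (bigD1 (Ordinal hb)) /= ?cE // [X in _ + X]big1 ?addr0.
    by rewrite !mxE /= !eqxx !mulr1.
  move=> b' /andP[_ b'b]; rewrite !mxE.
  suff -> : ((b' : nat) == b) = false by rewrite mulr0.
  by apply: contraNF b'b => /eqP bE; apply/eqP/val_inj.
rewrite mulr0 big1 // => b' /eqP abc; rewrite !mxE.
suff -> : ((b' : nat) == b) = false by rewrite mulr0.
by apply: contraNF cN => /eqP bE; rewrite -abc bE.
Qed.

Lemma ion_free2 a b r1 r2 : (a < 2 ^ N)%N -> (b < 2 ^ N)%N -> a != b ->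
  (r1 *: i_ a + r2 *: i_ b == 0) = (r1 == 0) && (r2 == 0).
Proof.
move=> ha hb ab; apply/eqP/andP => [E | [/eqP-> /eqP->]]; last first.
  by rewrite !scale0r addr0.
have := congr1 (fun x : 'rV[R]_(2 ^ N) => x 0 (Ordinal ha)) E.
have := congr1 (fun x : 'rV[R]_(2 ^ N) => x 0 (Ordinal hb)) E.
rewrite !mxE /= !eqxx [b == a]eq_sym (negPf ab) !mulr0 !mulr1 add0r addr0.
by move=> -> ->.
Qed.

Lemma zero_product_gens S u v s t :
  zero_product R N S u v s t <->
  mul (i_ u + (-1) ^+ s *: i_ (gen N + u ^^ S))
      (i_ v + (-1) ^+ t *: i_ (gen N + v ^^ S)) = 0.
Proof.
split=> [zp | z x y /vlineP[r ->] /vlineP[r' ->]].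
  by apply: zp; apply: memv_line.
by rewrite ions_mulZl ions_mulZr z !scaler0.
Qed.

(** The product of two diagonals, expanded: the four terms pair up on two basis
    units, and a sum of two signs vanishes when they are opposite. *)
Lemma zero_product_signs S u v s t (U := (gen N + u ^^ S)%N)
    (V := (gen N + v ^^ S)%N) :
    (u < 2 ^ N)%N -> (v < 2 ^ N)%N -> (U < 2 ^ N)%N -> (V < 2 ^ N)%N ->
    U ^^ V = u ^^ v -> U ^^ v = u ^^ V -> u ^^ v != u ^^ V ->
  zero_product R N S u v s t <->
  (ion_neg N u v (+) ((s (+) t) (+) ion_neg N U V)) &&
  ((t (+) ion_neg N u V) (+) (s (+) ion_neg N U v)).
Proof.
move=> uN vN UN VN UV Uv uvV; rewrite zero_product_gens -/U -/V.
rewrite ions_mulDl !ions_mulDr !(ions_mulZl, ions_mulZr) !ions_mul_ion //.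
rewrite UV Uv !ion_signE !scalerA -!signr_addb.
rewrite [X in _ + X]addrC addrACA -!scalerDl (rwP eqP).
by rewrite ion_free2 ?sum_signs_eq0 // lxor_lt.
Qed.

End Algebra.

Section Labels.
Variables (R : realType) (k S : nat).
Hypotheses (k1 : 1 < k) (S_bnd : 0 < S < 2 ^ k).
Local Notation G := (2 ^ k).

(** Both conditions come from [zero_product_signs] by the doubling rules.  On the
    long diagonals, where [u] is [v] or [v'], squares of units and Rule 1 take
    over, and the two conditions ask for opposite values of [s (+) t]. *)
Lemma zero_product_label u v s t :
    0 < u < G -> u != S -> 0 < v < G -> v != S ->
  let u' := u ^^ S in let v' := v ^^ S in
  zero_product R k.+1 S u v s t <->
  [/\ u != v, u != v',
      s (+) t = ion_neg k u v (+) ion_neg k u' v'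
    & s (+) t = ~~ (ion_neg k u v' (+) ion_neg k u' v)].
Proof.
move=> uP uS vP vS u' v'.
have [u'P u'S u'u] := label_opposite S_bnd uP uS.
have [v'P v'S v'v] := label_opposite S_bnd vP vS.
have [S0 SG] := andP S_bnd.
have [/andP[u0 uG] /andP[v0 vG]] := (uP, vP).
have [/andP[u'0 u'G] /andP[v'0 v'G]] := (u'P, v'P).
have GG : 2 ^ k.+1 = G + G by rewrite expnS mul2n addnn.
have genE : gen k.+1 = G by [].
have uvE : (G + u') ^^ (G + v') = u ^^ v.
  rewrite lxor_high2 // /u' /v' [v ^^ S]Nat.lxor_comm -Nat.lxor_assoc.
  by rewrite lxorK.
have uV : u ^^ (G + v') = G + (u ^^ v) ^^ S.
  by rewrite lxor_highr // /v' Nat.lxor_assoc.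
have Uv : (G + u') ^^ v = G + (u ^^ v) ^^ S.
  rewrite lxor_highl // /u' Nat.lxor_assoc [S ^^ v]Nat.lxor_comm.
  by rewrite -Nat.lxor_assoc.
have uv_lt := lxor_lt uG vG; have uvS_lt := lxor_lt uv_lt SG.
have := @zero_product_signs R k.+1 S u v s t; rewrite genE -/u' -/v' /=.
move=> ->; rewrite ?uV ?Uv; try lia.
have [uv | uv] := eqVneq u v.
  have v'E : v' = u' by rewrite /v' -uv.
  have neg_xx x : x != 0 -> ion_neg k.+1 x x by rewrite /ion_neg eqxx => ->.
  rewrite v'E -uv !neg_xx; [|lia..].
  rewrite ion_neg_low_high ?ion_neg_high_low // 1?eq_sym //.
  rewrite (ion_neg_swap k1 uP u'P) 1?eq_sym //.
  by case: (ion_neg _ _ _); case: s; case: t; split=> // -[].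
have [uv' | uv'] := eqVneq u v'.
  have vE : v = u' by rewrite /u' uv' lxorK.
  rewrite -uv' vE; have [_ _ _ _ [_ ->]] := ion_neg_gen k1 uP.
  have [_ _ _ _ [-> _]] := ion_neg_gen k1 u'P.
  rewrite ion_neg_low // ion_neg_high2 //.
  by case: (ion_neg _ _ _); case: s; case: t; split=> // -[].
have u'v : u' != v.
  by apply: contraNneq uv' => u'v; rewrite -[u](lxorK S) -/u' u'v.
have u'v' : u' != v' by rewrite (inj_eq (can_inj (lxorK S))).
rewrite ion_neg_low // ion_neg_high2 // ion_neg_low_high // ion_neg_high_low //.
rewrite (ion_neg_swap k1 u'P v'P) // (ion_neg_swap k1 uP v'P) //.
rewrite (ion_neg_swap k1 u'P vP) //.
by do 4!case: (ion_neg _ _ _); case: s; case: t; split=> // -[].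
Qed.

End Labels.

(** Raising both labels by [2 ^ k] reverses all four signs; the annihilating
    pairs of diagonals depend on them only through products of two. *)
Lemma zero_product_shift (R : realType) k S u v s t : 1 < k -> 0 < S < 2 ^ k ->
    0 < u < 2 ^ k -> u != S -> 0 < v < 2 ^ k -> v != S ->
  zero_product R k.+2 S (2 ^ k + u) (2 ^ k + v) s t <->
  zero_product R k.+1 S u v s t.
Proof.
move=> k1 SP uP uS vP vS; have [/andP[u0 uG] /andP[v0 vG]] := (uP, vP).
have [S0 SG] := andP SP.
have GG : 2 ^ k.+1 = 2 ^ k + 2 ^ k by rewrite expnS mul2n addnn.
have [u'P u'S _] := label_opposite SP uP uS.
have [v'P v'S _] := label_opposite SP vP vS.
rewrite !zero_product_label //; try lia.
rewrite !lxor_highl // !eqn_add2l.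
have [-> | uv] := eqVneq u v; first by split=> -[].
have [uv' | uv'] := eqVneq u (v ^^ S); first by split=> -[].
have u'v : u ^^ S != v by apply: contraNneq uv' => <-; rewrite lxorK.
have u'v' : u ^^ S != v ^^ S by rewrite (inj_eq (can_inj (lxorK S))).
rewrite !ion_neg_high2 //.
rewrite (ion_neg_swap k1 u'P v'P) // (ion_neg_swap k1 uP vP) //.
rewrite (ion_neg_swap k1 u'P vP) // (ion_neg_swap k1 uP v'P) //.
by do 4!case: (ion_neg _ _ _).
Qed.

Section DMZ.
Variables (R : realType) (k S : nat).
Hypotheses (k1 : 1 < k) (S_bnd : 0 < S < 2 ^ k).
Variables (u v : nat).
Hypotheses (uP : 0 < u < 2 ^ k) (uS : u != S).
Hypotheses (vP : 0 < v < 2 ^ k) (vS : v != S).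
Let u' := u ^^ S.
Let v' := v ^^ S.

(** Some slopes annihilate each other as soon as the two values prescribed for
    [s (+) t] agree. *)
Lemma DMZ_label : DMZ R k.+1 S u v <->
  [/\ u != v, u != v'
    & (ion_neg k u v (+) ion_neg k u' v') (+)
      (ion_neg k u v' (+) ion_neg k u' v)].
Proof.
split=> [[s [t /zero_product_label[] // -> -> E]]|[uv uv' E]].
  rewrite -/u' -/v' in E * => E'; split=> //.
  by rewrite -E E' addbC addbN addbb.
exists (ion_neg k u v (+) ion_neg k u' v'), false.
apply/zero_product_label => //; rewrite -/u' -/v' addbF; split=> //.
by move: E; case: (ion_neg k u v (+) _); case: (ion_neg k u v' (+) _).
Qed.

Lemma edge_sign_label p q : interior k.+1 p -> interior k.+1 q ->
    label k.+1 S p = u -> label k.+1 S q = v -> DMZ R k.+1 S u v ->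
  edge_sign R k.+1 S p q (~~ (ion_neg k u v (+) ion_neg k u' v')).
Proof.
move=> ip iq pu qv uv; split; first by rewrite /filled pu qv.
move=> s t; rewrite pu qv => /zero_product_label[] // _ _ <- _.
by case: s; case: t.
Qed.

End DMZ.

(** Exchanging the labels reverses all four signs. *)
Lemma DMZ_sym (R : realType) k S u v : 1 < k -> 0 < S < 2 ^ k ->
    0 < u < 2 ^ k -> u != S -> 0 < v < 2 ^ k -> v != S ->
  DMZ R k.+1 S u v -> DMZ R k.+1 S v u.
Proof.
move=> k1 SP uP uS vP vS; have [u'P _ _] := label_opposite SP uP uS.
have [v'P _ _] := label_opposite SP vP vS.
move=> /DMZ_label[] // uv uv' E; apply/DMZ_label => //.
have u'v : u ^^ S != v by apply: contraNneq uv' => <-; rewrite lxorK.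
have u'v' : u ^^ S != v ^^ S by rewrite (inj_eq (can_inj (lxorK S))).
rewrite eq_sym uv eq_sym u'v; split=> //.
rewrite (ion_neg_swap k1 u'P v'P) // (ion_neg_swap k1 uP vP) //.
rewrite (ion_neg_swap k1 u'P vP) // (ion_neg_swap k1 uP v'P) //.
by move: E; do 4!case: (ion_neg _ _ _).
Qed.

(** Replacing [v] by its opposite permutes the four signs. *)
Lemma DMZ_opp (R : realType) k S u v : 1 < k -> 0 < S < 2 ^ k ->
    0 < u < 2 ^ k -> u != S -> 0 < v < 2 ^ k -> v != S ->
  DMZ R k.+1 S u v -> DMZ R k.+1 S u (v ^^ S).
Proof.
move=> k1 SP uP uS vP vS; have [v'P v'S _] := label_opposite SP vP vS.
move=> /DMZ_label[] // uv uv' E; apply/DMZ_label => //.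
by rewrite lxorK uv uv' addbC.
Qed.

(** The generator pairs with every raised label: the signs of [i_(2 ^ k)] with
    [2 ^ k + v] and [2 ^ k + (v xor S)] agree, and the other two are those of
    [v] and [v xor S] with [S], which [ion_neg_opposite] makes differ. *)
Lemma DMZ_border (R : realType) k S v : 1 < k -> 0 < S < 2 ^ k ->
    0 < v < 2 ^ k -> v != S ->
  DMZ R k.+2 S (2 ^ k) (2 ^ k + v).
Proof.
move=> k1 SP vP vS; have [v'P v'S _] := label_opposite SP vP vS.
have [[S0 SG] [v0 vG]] := (andP SP, andP vP).
have G0 : 0 < 2 ^ k by rewrite expn_gt0.
have GG : 2 ^ k.+1 = 2 ^ k + 2 ^ k by rewrite expnS mul2n addnn.
apply/DMZ_label; try lia.
rewrite lxor_highl // -addn_pow2_lxor //.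
have [_ _ -> _ _] := ion_neg_gen k1 vP; have [_ _ -> _ _] := ion_neg_gen k1 v'P.
rewrite !ion_neg_high2 1?eq_sym // ion_neg_opposite //.
by split; [lia | lia | case: (ion_neg _ _ _)].
Qed.

(** * The label order *)

(** Inserting the digit 0 at place [s] of [p]: the digits of [p] from place [s]
    on count twice. *)
Definition low_label (s p : nat) : nat := p + p %/ 2 ^ s * 2 ^ s.

Lemma low_label_lt s : {mono low_label s : p q / p < q}.
Proof.
move=> p q; rewrite /low_label; case: (ltnP p q) => [pq|qp].
  by rewrite -addSn leq_add // leq_mul2r leq_div2r ?orbT // ltnW.
by apply/negbTE; rewrite -leqNgt leq_add // leq_mul2r leq_div2r ?orbT.
Qed.

Lemma low_label_inj s : injective (low_label s).
Proof.
move=> p q pq; have := low_label_lt s p q; have := low_label_lt s q p.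
by rewrite pq ltnn; lia.
Qed.

Lemma divn_low_label s p : low_label s p %/ 2 ^ s = (p %/ 2 ^ s).*2.
Proof. by rewrite divnDMl ?expn_gt0 // addnn. Qed.

(** Digits at or above place [s] move up by one, so [2 ^ n] becomes
    [2 ^ n.+1]; this is what places the raised labels in the central block. *)
Lemma low_labelDl s n p : s <= n ->
  low_label s (2 ^ n + p) = 2 ^ n.+1 + low_label s p.
Proof.
move=> sn; rewrite /low_label divnDl ?dvdn_exp2l // mulnDl divnK ?dvdn_exp2l //.
by rewrite expnS; lia.
Qed.

Lemma low_labelP s u : ~~ odd (u %/ 2 ^ s) -> exists p, low_label s p = u.
Proof.
have s0 : 0 < 2 ^ s by rewrite expn_gt0.
move=> /negPf ev; exists ((u %/ 2 ^ s)./2 * 2 ^ s + u %% 2 ^ s).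
rewrite /low_label divnMDl // [_ %% _ %/ _]divn_small ?ltn_mod // addn0.
have uE := odd_double_half (u %/ 2 ^ s); rewrite ev add0n in uE.
by rewrite addnC addnA -mulnDl addnn uE -divn_eq.
Qed.

(** At level [n.+2], with [2 ^ s] the top bit of [S]. *)
Section Table.
Variables (n s S : nat).
Hypotheses (sn : s <= n) (S_lo : 2 ^ s <= S) (S_hi : S < 2 ^ s.+1).
Local Notation G := (2 ^ n.+1).
Local Notation lam := (low_label s).

Let s0 : 0 < 2 ^ s. Proof. by rewrite expn_gt0. Qed.

Let SE : S %/ 2 ^ s = 1.
Proof.
move: S_hi; rewrite expnS => hi.
by rewrite -(subnKC S_lo) divnDl // divnn s0 divn_small //; lia.
Qed.

Lemma odd_opposite u : odd ((u ^^ S) %/ 2 ^ s) = ~~ odd (u %/ 2 ^ s).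
Proof. by rewrite divn_lxor odd_lxor SE addbT. Qed.

(** Hence a label with the digit [2 ^ s] is met after its opposite, which has
    already placed it. *)
Lemma high_label_gt_opposite u : odd (u %/ 2 ^ s) -> u ^^ S < u.
Proof.
set d := u %/ 2 ^ s => od; rewrite ltnNge.
apply/negP => /leq_div2r - /(_ (2 ^ s)).
rewrite divn_lxor SE -/d; apply/negP; rewrite -ltnNge.
have := divn_lxor 1 d 1; rewrite [1 %/ _]divn_small // Nat.lxor_0_r !divn2.
move=> hE; rewrite -[X in X < _]odd_double_half -[X in _ < X]odd_double_half.
by rewrite hE odd_lxor od.
Qed.

(** The placement once the integers up to [m] have been met: the labels without
    the digit [2 ^ s] fill the left half in order, their opposites the mirror
    positions. *)
Definition partial_table (m : nat) : seq nat :=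
  mkseq (fun p =>
    let q := if p < 2 ^ n then p else G - 1 - p in
    if (0 < q) && (lam q <= m) then
      if p < 2 ^ n then lam q else lam q ^^ S
    else 0) G.

Let GE : G = 2 ^ n + 2 ^ n. Proof. by rewrite expnS mul2n addnn. Qed.

Lemma odd_low_label q : odd (lam q %/ 2 ^ s) = false.
Proof. by rewrite divn_low_label odd_double. Qed.

Lemma low_label_opposite_neq p q : lam p ^^ S != lam q.
Proof.
apply/eqP => /(congr1 (fun u => odd (u %/ 2 ^ s))).
by rewrite odd_opposite !odd_low_label.
Qed.

Lemma low_label0 : lam 0 = 0. Proof. by rewrite /low_label div0n. Qed.

Lemma low_label_gt0 q : (0 < lam q) = (0 < q).
Proof. by rewrite -{1}low_label0 low_label_lt. Qed.

Lemma low_label_ltG q : (lam q < G) = (q < 2 ^ n).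
Proof.
have <- : lam (2 ^ n) = G.
  by rewrite -[2 ^ n]addn0 low_labelDl // low_label0 addn0.
exact: low_label_lt.
Qed.

Lemma low_label_neqS q : lam q != S.
Proof.
by apply/eqP => /(congr1 (fun u => odd (u %/ 2 ^ s))); rewrite odd_low_label SE.
Qed.

Lemma nth_partial_table m p : nth 0 (partial_table m) p =
  if p < G then
    let q := if p < 2 ^ n then p else G - 1 - p in
    if (0 < q) && (lam q <= m) then
      if p < 2 ^ n then lam q else lam q ^^ S
    else 0
  else 0.
Proof.
have [pG | pG] := ltnP p G; first by rewrite nth_mkseq.
by rewrite nth_default // size_mkseq.
Qed.

(** Only a label without the digit [2 ^ s] changes the table, and the leftmost
    free position is then its rank among those labels. *)
Lemma place_partial_table m : m.+1 < G ->
  place G S (partial_table m) m.+1 = partial_table m.+1.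
Proof.
move=> mG; rewrite /place; set u := m.+1.
have keep : (forall q, lam q != u) -> partial_table m = partial_table u.
  move=> lam_neq; apply: eq_mkseq => p /=.
  by rewrite [lam _ <= u]leq_eqVlt (negPf (lam_neq _)).
have [uS | uS] /= := eqVneq u S.
  by apply: keep => q; rewrite uS low_label_neqS.
have [od | /low_labelP[p pu]] := boolP (odd (u %/ 2 ^ s)).
  (* The opposite of [u] was met earlier and placed [u]. *)
  rewrite ifT.
    apply: keep => q; apply/eqP => qu.
    by move: od; rewrite -qu odd_low_label.
  have u'u := high_label_gt_opposite od.
  have [q qu'] : exists q, lam q = u ^^ S.
    by apply: low_labelP; rewrite odd_opposite od.
  have q0 : 0 < q by rewrite -low_label_gt0 qu' lt0n lxor_eq0.
  have qh : q < 2 ^ n by rewrite -low_label_ltG qu'; lia.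
  apply/(nthP 0); exists (G - 1 - q); first by rewrite size_mkseq; lia.
  rewrite nth_partial_table /=.
  have -> : G - 1 - q < G by lia.
  have -> : G - 1 - q < 2 ^ n = false by lia.
  have -> : G - 1 - (G - 1 - q) = q by lia.
  by rewrite q0 qu' -ltnS u'u /= lxorK.
have p0 : 0 < p by rewrite -low_label_gt0 pu.
have ph : p < 2 ^ n by rewrite -low_label_ltG pu.
rewrite ifF; last first.
  apply/negP => /(nthP 0)[i]; rewrite size_mkseq => iG.
  rewrite nth_partial_table iG /=; case: ifP => // /andP[_ le].
  case: ifP => _ E; first by move: le; rewrite E ltnn.
  by move/eqP: E; rewrite -pu (negPf (low_label_opposite_neq _ _)).
(* Every position left of [p] holds a smaller label, and [p] itself is free
   because its label [u] exceeds [m]. *)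
have -> : (index 0 (behead (partial_table m))).+1 = p.
  rewrite -[p in RHS]prednK //; congr _.+1.
  set t := behead _.
  have nthE i : nth 0 t i = nth 0 (partial_table m) i.+1 by rewrite nth_behead.
  have free : nth 0 t p.-1 = 0.
    rewrite nthE prednK // nth_partial_table ph /= pu ltnn andbF.
    by case: ifP.
  apply/eqP; rewrite eqn_leq; apply/andP; split.
    rewrite leqNgt; apply/negP => /(before_find 0) /=.
    by rewrite free eqxx.
  rewrite leqNgt; apply/negP => lt_ip.
  have size_t : size t = G.-1 by rewrite size_behead size_mkseq.
  have : index 0 t < size t by lia.
  rewrite index_mem => /(nth_index 0); rewrite nthE nth_partial_table.
  set i := (index _ _).+1 in lt_ip *.
  have ip : i < p by lia.
  have -> : i < G by lia.
  have -> : i < 2 ^ n by lia.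
  rewrite /= -ltnS -/u -pu low_label_lt ip => /eqP.
  by rewrite -leqn0 leqNgt low_label_gt0.
(* Between [m] and [u] only position [p] and its mirror change. *)
apply: (@eq_from_nth _ 0) => [|i].
  by rewrite !size_set_nth !size_mkseq; lia.
rewrite !size_set_nth !size_mkseq => iG'.
have iG : i < G by lia.
rewrite !nth_set_nth /= nth_set_nth /= !nth_partial_table iG /=.
have [iE | iN] := eqVneq i (G - 1 - p).
  rewrite iE.
  have -> : G - 1 - p < 2 ^ n = false by lia.
  have -> : G - 1 - (G - 1 - p) = p by lia.
  by rewrite p0 pu leqnn.
have [-> | ip] := eqVneq i p; first by rewrite ph p0 pu leqnn.
set q := if i < _ then _ else _.
have qp : q != p by rewrite /q; case: ltnP; lia.
have -> : (lam q <= u) = (lam q <= m) => //.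
rewrite [LHS]leq_eqVlt -pu (inj_eq (@low_label_inj s)) (negPf qp) /=.
by rewrite pu.
Qed.

Lemma label_tableE : S < G -> label_table n.+2 S = partial_table G.-1.
Proof.
move=> SG; rewrite /label_table /gen /= subn1.
have : G.-1 < G by rewrite ltn_predL expn_gt0.
elim: G.-1 => [_|m IHm mG].
  apply: (@eq_from_nth _ 0) => [|i]; rewrite ?size_mkseq ?size_nseq // => iG.
  rewrite nth_nseq iG nth_partial_table iG /=.
  by rewrite [lam _ <= 0]leqNgt low_label_gt0 andbN.
have -> : iota 1 m.+1 = iota 1 m ++ [:: m.+1].
  by rewrite -(addn1 m) iotaD add1n addn1.
rewrite foldl_cat IHm ?(ltnW mG) //=.
exact: place_partial_table.
Qed.

Lemma labelE p : 0 < p < G - 1 -> label n.+2 S p =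
  if p < 2 ^ n then lam p else lam (G - 1 - p) ^^ S.
Proof.
move=> pP; have SG : S < G by apply: leq_trans S_hi _; rewrite leq_exp2l.
rewrite /label label_tableE // nth_partial_table.
have -> : p < G by lia.
have le q : q < 2 ^ n -> lam q <= G.-1.
  by rewrite -low_label_ltG; case: G.
have [ph | ph] := ltnP p (2 ^ n); rewrite /= le ?andbT; try lia.
  by rewrite ifT //; case/andP: pP.
by rewrite ifT //; lia.
Qed.

Lemma label_bounds p : 0 < p < G - 1 ->
  0 < label n.+2 S p < G /\ label n.+2 S p != S.
Proof.
move=> pP; rewrite labelE //; have SG : S < 2 ^ n.+1.
  by apply: leq_trans S_hi _; rewrite leq_exp2l.
case: (ltnP p) => ph.
  by rewrite low_label_gt0 low_label_ltG low_label_neqS ph; case/andP: pP => ->.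
have q0 : 0 < lam (G - 1 - p) by rewrite low_label_gt0; lia.
have qG : lam (G - 1 - p) < G by rewrite low_label_ltG; lia.
by rewrite lxor_lt // lt0n lxor_eq0 low_label_neqS -lxor_eq0 lxorK -lt0n.
Qed.

End Table.

Section TwoTables.
Variables (n s S : nat).
Hypotheses (sn : s <= n) (S_lo : 2 ^ s <= S) (S_hi : S < 2 ^ s.+1).
Let GE : 2 ^ n.+1 = 2 ^ n + 2 ^ n. Proof. by rewrite expnS mul2n addnn. Qed.
Let G'E : 2 ^ n.+2 = 2 ^ n.+1 + 2 ^ n.+1.
Proof. by rewrite expnS mul2n addnn. Qed.

(** On the mirrored half, positions [2 ^ n + p] and [p] have mirror images that
    again differ by [2 ^ n], and opposition keeps the digit [2 ^ n.+1]. *)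
Lemma label_shift p : 0 < p < 2 ^ n.+1 - 1 ->
  label n.+3 S (2 ^ n + p) = 2 ^ n.+1 + label n.+2 S p.
Proof.
move=> pP; have sn' : s <= n.+1 by apply: leqW.
have SG : S < 2 ^ n.+1 by apply: leq_trans S_hi _; rewrite leq_exp2l.
rewrite (labelE sn' S_lo S_hi) ?(labelE sn S_lo S_hi) //; last by lia.
have -> : (2 ^ n + p < 2 ^ n.+1) = (p < 2 ^ n) by lia.
case: (ltnP p) => ph; first by rewrite low_labelDl.
have -> : 2 ^ n.+2 - 1 - (2 ^ n + p) = 2 ^ n + (2 ^ n.+1 - 1 - p) by lia.
by rewrite low_labelDl // lxor_highl // low_label_ltG //; lia.
Qed.

Lemma label_centre_first : label n.+3 S (2 ^ n) = 2 ^ n.+1.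
Proof.
have sn' : s <= n.+1 by apply: leqW.
have n0 : 0 < 2 ^ n by rewrite expn_gt0.
rewrite (labelE sn' S_lo S_hi); last by lia.
rewrite ifT; last by lia.
by rewrite -{1}[2 ^ n]addn0 low_labelDl // low_label0 addn0.
Qed.

Lemma label_centre_last : label n.+3 S (2 ^ n + (2 ^ n.+1 - 1)) = 2 ^ n.+1 + S.
Proof.
have sn' : s <= n.+1 by apply: leqW.
have SG : S < 2 ^ n.+1 by apply: leq_trans S_hi _; rewrite leq_exp2l.
have n0 : 0 < 2 ^ n by rewrite expn_gt0.
rewrite (labelE sn' S_lo S_hi) ?ifF; try lia.
have -> : 2 ^ n.+2 - 1 - (2 ^ n + (2 ^ n.+1 - 1)) = 2 ^ n + 0 by lia.
by rewrite low_labelDl // low_label0 lxor_highl ?expn_gt0 // Nat.lxor_0_l.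
Qed.

End TwoTables.

(** * The central block *)

Theorem theorem11 (R : realType) (N S : nat)
    (S_gt8 : (8 < S)%N)
    (S_not_pow2 : ~ exists k : nat, S = (2 ^ k)%N)
    (S_lt : (S < 2 ^ N.-1)%N) :
  let G := (2 ^ N.-1)%N in
  let h := (2 ^ (N - 2))%N in
  (* (1); rows and columns carry the same labels, so the first two conjuncts
     concern the first and last rows and the first and last columns alike *)
  [/\ interior N.+1 h /\ label N.+1 S h = G,
      interior N.+1 (h + (G - 1)) /\ label N.+1 S (h + (G - 1)) = (G + S)%N
    & forall p q x : nat, label_line N S p q x ->
        filled R N.+1 S (h + p) (h + q) /\ content N.+1 S (h + p) (h + q) = x]
  /\
  (* (2) *)
  (forall p q : nat, (1 <= p <= G - 2)%N -> (1 <= q <= G - 2)%N ->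
     (filled R N.+1 S (h + p) (h + q) <-> filled R N S p q) /\
     (filled R N S p q ->
        content N.+1 S (h + p) (h + q) = content N S p q /\
        exists mark : bool,
          edge_sign R N S p q mark /\
          edge_sign R N.+1 S (h + p) (h + q) mark)).
Proof.
case: N S_lt => [|[|n]]; [rewrite /=; lia.. | move=> S_lt G h].
have [s /andP[S_lo S_hi]] : exists s, (2 ^ s <= S < 2 ^ s.+1)%N.
  by exists (trunc_log 2 S); rewrite trunc_logP ?trunc_log_ltn //; lia.
have s_le : (s <= n)%N by rewrite -ltnS -(@ltn_exp2l 2) // (leq_ltn_trans S_lo).
have n_gt0 : (1 < n.+1)%N.
  by rewrite -(@ltn_exp2l 2) // (leq_ltn_trans _ S_lt) // (leq_trans _ S_gt8).
have S_bnd : (0 < S < 2 ^ n.+1)%N by rewrite S_lt (leq_trans _ S_gt8).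
have hE : h = (2 ^ n)%N by rewrite /h subn2.
have GE : G = (h + h)%N by rewrite hE /G /= expnS mul2n addnn.
have G2E : (2 ^ n.+2 = G + G)%N by rewrite expnS mul2n addnn.
have G_gt8 : (8 < G)%N by apply: ltn_trans S_lt.
have h_int p : (p < G)%N -> interior n.+3 (h + p).
  by rewrite /interior /gen /= G2E; lia.
have h_int0 : interior n.+3 h by rewrite -[h]addn0; apply: h_int; lia.
have int_bnd p : interior n.+2 p -> (0 < p < G - 1)%N.
  by rewrite /interior /gen /= -/G; lia.
have int_lt p : interior n.+2 p -> (p < G)%N by move/int_bnd; lia.
have lab_bnd p : interior n.+2 p ->
    (0 < label n.+2 S p < G)%N /\ label n.+2 S p != S.
  by move/int_bnd => pP; apply: (label_bounds s_le).
have lab_shift p : interior n.+2 p ->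
    label n.+3 S (h + p) = (G + label n.+2 S p)%N.
  by move/int_bnd => pP; rewrite hE; apply: (label_shift s_le).
have lab_first : label n.+3 S h = G.
  by rewrite hE; apply: (label_centre_first s_le).
have lab_last : label n.+3 S (h + (G - 1)) = (G + S)%N.
  by rewrite hE; apply: (label_centre_last s_le).
split.
  split; first by [].
    by split=> //; apply: h_int; lia.
  have border p : interior n.+2 p -> let u := label n.+2 S p in
      [/\ DMZ R n.+3 S G (G + u), DMZ R n.+3 S (G + u) G,
          DMZ R n.+3 S (G + S) (G + u) & DMZ R n.+3 S (G + u) (G + S)].
    move=> ip u; have [uP uS] := lab_bnd _ ip.
    (* Exchanging the labels and passing to an opposite turn the first pair
       into the other three. *)
    have D1 : DMZ R n.+3 S G (G + u) by apply: DMZ_border.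
    have D2 : DMZ R n.+3 S (G + u) G.
      by apply: DMZ_sym D1; rewrite ?G2E; lia.
    have D4 : DMZ R n.+3 S (G + u) (G + S).
      rewrite (@addn_pow2_lxor n.+1 S) //; apply: DMZ_opp D2; rewrite ?G2E; lia.
    by split=> //; apply: DMZ_sym D4; rewrite ?G2E; lia.
  have [_ SG] := andP S_bnd.
  have G_xor u : (u < G)%N -> Nat.lxor G (G + u) = u.
    move=> uG; rewrite -[G in Nat.lxor G _]addn0.
    by rewrite lxor_high2 ?Nat.lxor_0_l //; lia.
  move=> p q x [{p} {}q | {q} {}p | {p} {}q | {q} {}p] ip;
    have [D1 D2 D3 D4] := border _ ip;
    have [/andP[_ uG] _] := lab_bnd _ ip; have p_lt := int_lt _ ip;
    rewrite -?[gen n.+2]/G /filled /content ?addn0 ?lab_first ?lab_last;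
    rewrite lab_shift //.
  - by rewrite G_xor //; split=> //; split; rewrite ?h_int0 ?h_int //; lia.
  - rewrite Nat.lxor_comm G_xor //; split=> //.
    by split; rewrite ?h_int0 ?h_int //; lia.
  - rewrite lxor_high2 // Nat.lxor_comm; split=> //.
    by split; rewrite ?h_int //; lia.
  - by rewrite lxor_high2 //; split=> //; split; rewrite ?h_int //; lia.
move=> p q ip iq.
have [[uP uS] [vP vS]] := (lab_bnd _ ip, lab_bnd _ iq).
have [[/andP[_ uG] _] [/andP[_ vG] _]] := (lab_bnd _ ip, lab_bnd _ iq).
have [ip' iq'] := (h_int _ (int_lt _ ip), h_int _ (int_lt _ iq)).
have zpE s' t' :
    zero_product R n.+3 S (label n.+3 S (h + p)) (label n.+3 S (h + q)) s' t'
    <-> zero_product R n.+2 S (label n.+2 S p) (label n.+2 S q) s' t'.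
  by rewrite !lab_shift //; apply: zero_product_shift.
have fE : filled R n.+3 S (h + p) (h + q) <-> filled R n.+2 S p q.
  by split=> -[_ _ [s' [t' /zpE zp]]]; split=> //; exists s', t'.
split=> // f; split.
  by rewrite /content !lab_shift // lxor_high2.
have [_ _ D] := f.
have [_ es] :=
  edge_sign_label n_gt0 S_bnd uP uS vP vS ip iq (erefl _) (erefl _) D.
eexists; split; split; [exact: f | exact: es | exact/fE |].
by move=> s' t' /zpE; exact: es.
Qed.
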